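(* The integrality gap of the spreading LP for the unbounded version of $2$-dimAP+ is $\Omega(k^{1/4})$; that is, there is an absolute constant $c>0$ such that for infinitely many $k$ there are instances of unbounded $2$-dimAP+ with $k$ terminals whose optimal integral cost is at least $c\,k^{1/4}$ times the optimal LP value.
   Context: Unbounded $2$-dimAP+: the input is a graph $G=(V,E)$, nonnegative edge weights $w$, terminals $T\subseteq V$ with $|T|=k$, and an injective $f_0:T\to\mathbb{Z}^2$; a feasible solution is an injective $f:V\to\mathbb{Z}^2$ with $f|_T=f_0$, of cost $\sum_{\{u,v\}\in E}w_{uv}\|f(u)-f(v)\|_2$, to be minimized. The spreading LP has as variables a metric $d$ on $V$ and is: minimize $\sum_{\{u,v\}\in E}w_{uv}\,d(u,v)$ subject to $\sum_{v\in S}d(u,v)\geq (|S|-1)^{1+1/2}/4$ for all $S\subseteq V$ and $u\in S$, and $d(u,v)=\|f_0(u)-f_0(v)\|_2$ for all $u,v\in T$. The integrality gap is the supremum over instances of the ratio of the optimal integral cost to the optimal LP value. *)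

(* Defs.v *)
From mathcomp Require Import all_boot all_order all_algebra.
From mathcomp Require Import all_classical all_reals all_analysis.

Set Implicit Arguments.
Unset Strict Implicit.
Unset Printing Implicit Defensive.

Import Order.TTheory GRing.Theory Num.Theory.

Local Open Scope classical_set_scope.
Local Open Scope ring_scope.

Definition dist2 (R : realType) (p q : int * int) : R :=
  Num.sqrt (((p.1 - q.1) ^+ 2 + (p.2 - q.2) ^+ 2)%:~R).

(* The graph is finite and simple; only the values of [weight] on edges and of
   [pos0] on [terminals] are meaningful. *)
Record instance (R : realType) := Instance {
  vertex : finType;
  edge : rel vertex;
  edge_sym : symmetric edge;
  edge_irr : irreflexive edge;
  weight : vertex -> vertex -> R;
  weight_sym : forall u v, edge u v -> weight u v = weight v u;
  weight_ge0 : forall u v, edge u v -> 0 <= weight u v;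
  terminals : {set vertex};
  pos0 : vertex -> int * int;
  pos0_inj : {in terminals &, injective pos0}
}.

Section Problem.
Variables (R : realType) (I : instance R).
Local Notation V := (vertex I).

(* The double sum meets every edge {u, v} twice, as (u, v) and as (v, u). *)
Definition cost (d : V -> V -> R) : R :=
  (\sum_(u : V) \sum_(v : V | edge u v) weight u v * d u v) / 2.

Definition feasible (f : V -> int * int) : Prop :=
  injective f /\ {in terminals I, f =1 @pos0 R I}.

(* The infimum is over a nonempty set of nonnegative reals: the graph is finite
   and Z^2 is infinite. *)
Definition opt_value : R :=
  inf [set cost (fun u v => dist2 R (f u) (f v)) | f in feasible].

Definition is_metric (d : V -> V -> R) : Prop :=
  [/\ forall u v, 0 <= d u v,
      forall u v, d u v = 0 <-> u = v,
      forall u v, d u v = d v u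
    & forall u v x, d u x <= d u v + d v x].

Definition spreading (d : V -> V -> R) : Prop :=
  forall (S : {set V}) (u : V), u \in S ->
    (#|S|%:R - 1) `^ (1 + 1 / 2) / 4 <= \sum_(v in S) d u v.

Definition lp_feasible (d : V -> V -> R) : Prop :=
  [/\ is_metric d, spreading d
    & {in terminals I &, forall u v, d u v = dist2 R (pos0 u) (pos0 v)}].

(* The infimum over the empty set would be 0, a value that is excluded wherever
   a ratio to [lp_value] is formed. *)
Definition lp_value : R := inf [set cost d | d in lp_feasible].

End Problem.

(* Spreading gives d u v >= 1/4 for u <> v, so the condition 0 < lp_value only
   discards the instances with all weights zero, whose ratio would be 0 / 0. *)
Definition integrality_gap (R : realType) (k : nat) : \bar R :=
  ereal_sup [set r | exists I : instance R,
    [/\ #|terminals I| = k, 0 < lp_value I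
      & r = (opt_value I / lp_value I)%:E]].

(* Main.v *)
(* Let the terminals fill the (2m+1) x (2m+1) square of the lattice, so that
   k = (2m+1)^2, and join a single free vertex to the central terminal by an edge
   of weight 1.  An integral solution has to put the free vertex outside the square,
   at cost at least m+1.  The LP may place it at distance 2 from the center, its
   distances being those of the center plus 2: the lattice already spreads with a
   better constant (1/3 against 1/4) than the constraints ask for, so one extra
   point near the center violates none of them.  The ratio is thus at least
   (m+1)/2, of order k^(1/2). *)
Require Import Defs.
From mathcomp Require Import all_boot all_order all_algebra.
From mathcomp Require Import all_classical all_reals all_analysis.
From mathcomp Require Import ring lra zify.

Import Order.TTheory GRing.Theory Num.Theory.

Local Open Scope ring_scope.

(** * Euclidean and sup distances on the lattice *)

Section Dist2.
Variable R : realType.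
Implicit Types p q s : int * int.
Local Notation dist2 := (dist2 R).

Lemma dist2_ge0 p q : 0 <= dist2 p q.
Proof. exact: sqrtr_ge0. Qed.

Lemma sqr_dist2 p q :
  dist2 p q ^+ 2 = (p.1 - q.1)%:~R ^+ 2 + (p.2 - q.2)%:~R ^+ 2.
Proof.
rewrite sqr_sqrtr; first by rewrite rmorphD !rmorphXn.
by rewrite ler0z addr_ge0 // sqr_ge0.
Qed.

Lemma dist2C p q : dist2 p q = dist2 q p.
Proof. by rewrite /Defs.dist2; congr (Num.sqrt _%:~R); ring. Qed.

Lemma dist2xx p : dist2 p p = 0.
Proof. by rewrite /Defs.dist2 !subrr sqrtr0. Qed.

Lemma dist2_eq0 p q : dist2 p q = 0 -> p = q.
Proof.
move=> d0; have /esym/eqP := sqr_dist2 p q.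
rewrite d0 expr0n /= paddr_eq0 ?sqr_ge0 // !sqrf_eq0 !intr_eq0 !subr_eq0.
by case: p q {d0} => [? ?] [? ?] /= /andP[/eqP-> /eqP->].
Qed.

Lemma dist2_triangle q p s : dist2 p s <= dist2 p q + dist2 q s.
Proof.
rewrite -ler_sqr ?nnegrE ?addr_ge0 ?dist2_ge0 // sqrrD !sqr_dist2.
have -> : (p.1 - s.1)%:~R = (p.1 - q.1)%:~R + (q.1 - s.1)%:~R :> R.
  by rewrite -rmorphD /=; congr (_%:~R); ring.
have -> : (p.2 - s.2)%:~R = (p.2 - q.2)%:~R + (q.2 - s.2)%:~R :> R.
  by rewrite -rmorphD /=; congr (_%:~R); ring.
have := sqr_dist2 p q; have := sqr_dist2 q s.
have := dist2_ge0 p q; have := dist2_ge0 q s.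
move: (dist2 p q) (dist2 q s) => X Y.
move: ((p.1 - q.1)%:~R) ((q.1 - s.1)%:~R) ((p.2 - q.2)%:~R) ((q.2 - s.2)%:~R).
move=> a b c d Y0 X0 Y2 X2.
suff : a * b + c * d <= X * Y by lra.
apply: le_trans (ler_norm _) _.
rewrite -ler_sqr ?nnegrE ?mulr_ge0 // real_normK ?num_real // exprMn X2 Y2.
(* Cauchy-Schwarz by Lagrange's identity: this square is (a^2 + c^2)(b^2 + d^2) - (a b + c d)^2. *)
have : 0 <= (a * d - b * c) ^+ 2 by apply: sqr_ge0.
by lra.
Qed.

(** Balls of the sup norm are squares, whose lattice points are easy to count, and this norm bounds
    the Euclidean one from below. *)
Definition supdist p q : nat := maxn `|p.1 - q.1|%N `|p.2 - q.2|%N.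

Lemma supdist_le_dist2 p q : (supdist p q)%:R <= dist2 p q.
Proof.
rewrite -ler_sqr ?nnegrE ?dist2_ge0 ?ler0n // sqr_dist2.
have sqr_absz (z : int) : (`|z|%N%:R : R) ^+ 2 = z%:~R ^+ 2.
  by rewrite natr_absz intr_norm real_normK ?num_real.
rewrite /supdist; case: leqP => _; rewrite sqr_absz.
- by rewrite lerDr sqr_ge0.
- by rewrite lerDl sqr_ge0.
Qed.

End Dist2.

(** * Distance sums over distinct lattice points *)

Section LatticeSpreading.
Variables (V : finType) (f : V -> int * int) (A : {set V}) (p : int * int).
Hypothesis f_inj : {in A &, injective f}.

Lemma card_supdist_ball j :
  (#|[set x in A | (supdist (f x) p <= j)%N]| <= (2 * j + 1) ^ 2)%N.
Proof.
(* On the ball the shifted coordinates lie in [0, 2 j], so neither the absolute value nor [inord]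
   loses information. *)
pose g x : 'I_(2 * j).+1 * 'I_(2 * j).+1 :=
  (inord `|((f x).1 - p.1 + j%:Z)%R|%N, inord `|((f x).2 - p.2 + j%:Z)%R|%N).
have -> : ((2 * j + 1) ^ 2)%N = #|{: 'I_(2 * j).+1 * 'I_(2 * j).+1}|.
  by rewrite card_prod !card_ord; lia.
apply: (@leq_card_in _ _ g) => x y.
rewrite !inE /supdist => /andP[xA hx] /andP[yA hy] [/eqP].
rewrite -val_eqE /= !inordK; [|lia|lia] => /eqP e1 /eqP.
rewrite -val_eqE /= !inordK; [|lia|lia] => /eqP e2.
apply: f_inj => //; move: hx hy e1 e2.
by case: (f x) (f y) => [? ?] [? ?] /= *; congr (_, _); lia.
Qed.

Lemma sum_odd_squares r : (3 * (\sum_(j < r) (2 * j + 1) ^ 2) + r = 4 * r ^ 3)%N.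
Proof.
elim: r => [|r IH]; rewrite ?big_ord0 // big_ord_recr /=.
have -> : (4 * r.+1 ^ 3 = 4 * r ^ 3 + 3 * (2 * r + 1) ^ 2 + 1)%N by ring.
by rewrite -IH; ring.
Qed.

(* Layer cake: [r - h x] is the number of levels [j < r] with [h x <= j], and
   the ball of level [j] holds at most [(2 j + 1)^2] lattice points. *)
Lemma sum_supdist_ge r :
  (3 * (#|A| * r) + r <= 3 * (\sum_(x in A) supdist (f x) p) + 4 * r ^ 3)%N.
Proof.
have levels (h : nat) : (r <= h + \sum_(j < r) (h <= j))%N.
  elim: r => [//|r IH]; rewrite big_ord_recr /=.
  by case: (leqP h r) => /= hr; move: (\sum_(_ < _) _)%N IH => t; lia.
have : (#|A| * r <= \sum_(x in A) supdist (f x) p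
         + \sum_(j < r) #|[set x in A | (supdist (f x) p <= j)%N]|)%N.
  under [X in (_ + X)%N]eq_bigr => j _.
    rewrite -sum1_card; under eq_bigl do rewrite inE.
    rewrite big_mkcondr /=; over.
  rewrite exchange_big /= -big_split /= -sum_nat_const.
  by apply: leq_sum => x _; exact: levels.
have : (\sum_(j < r) #|[set x in A | (supdist (f x) p <= j)%N]|
         <= \sum_(j < r) (2 * j + 1) ^ 2)%N.
  by apply: leq_sum => j _; exact: card_supdist_ball.
have := sum_odd_squares r; lia.
Qed.

End LatticeSpreading.

(** The number [r] of levels stays free: the bound is best near r = sqrt(#|A|) / 2, where it is
    about #|A|^(3/2) / 3. *)
Lemma sum_dist2_ge (R : realType) (V : finType) (f : V -> int * int)
    (A : {set V}) (p : int * int) (r : nat) :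
  {in A &, injective f} ->
  #|A|%:R * r%:R + (r%:R - 4 * r%:R ^+ 3) / 3 <= \sum_(x in A) dist2 R p (f x).
Proof.
move=> f_inj; apply: le_trans (ler_sum _ (fun x _ => supdist_le_dist2 R p (f x))).
under [leRHS]eq_bigr => x _.
  have -> : supdist p (f x) = supdist (f x) p by rewrite /supdist; lia.
  over.
rewrite -natr_sum.
have := sum_supdist_ge V f A p f_inj r.
rewrite -(ler_nat R) !natrD !natrM.
by move: (\sum_(x in A) _)%N => s; lra.
Qed.

(** * Choice of the number of levels *)

Lemma half_nat_approx (R : realType) (q : R) : 0 <= q ->
  exists r : nat, [/\ (0 < r)%N, q <= 2 * r%:R + 2 & r = 1%N \/ 2 * r%:R <= q].
Proof.
move=> q0; have /andP[t1 t2] := truncn_itv (divr_ge0 q0 (ler0n R 2)).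
move: t1 t2; case: (Num.truncn _) => [|t] t1 t2.
  by exists 1%N; split; [|lra|left].
exists t.+1; split => //; last by right; lra.
by move: t2; rewrite -[t.+2]addn1 natrD; lra.
Qed.

Lemma powR_3_2 (R : realType) (n : nat) :
  n%:R `^ (1 + 1 / 2) = Num.sqrt n%:R ^+ 3 :> R.
Proof.
have [->|n0] := eqVneq n 0%N.
  by rewrite sqrtr0 expr0n powR0 //; apply/eqP; lra.
rewrite powRD ?pnatr_eq0 ?n0 ?implybT // powRr1 ?ler0n //.
by rewrite div1r powR12_sqrt ?ler0n // exprSr sqr_sqrtr ?ler0n.
Qed.

(* With [q = 2 r + s], [0 <= s <= 2], the difference of the two sides is
   [2/3 r^3 + r s (r - s/2) + O(1)]. *)
Lemma layer_cake_ge (R : realType) (q : R) : 0 <= q ->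
  exists r : nat,
    q ^+ 3 / 4 <= (q ^+ 2 + 1) * r%:R + (r%:R - 4 * r%:R ^+ 3) / 3 /\
    q ^+ 3 / 4 <= q ^+ 2 * r%:R + (r%:R - 4 * r%:R ^+ 3) / 3 + 2.
Proof.
move=> q0; have [r [r0 qr H]] := half_nat_approx R q q0.
exists r; case: H qr => [->|rq] qr.
  (* At r = 1 the right-hand sides are q^2 and q^2 + 1, and here q <= 4. *)
  have : 0 <= q ^+ 2 * (4 - q) by rewrite mulr_ge0 ?sqr_ge0 //; lra.
  by move=> h; split; lra.
move: r0 qr rq; rewrite -(ler_nat R); move: (r%:R) => x x1 qx xq.
pose s := q - 2 * x; have -> : q = 2 * x + s by rewrite /s; ring.
have s0 : 0 <= s by rewrite /s; lra.
have s2 : s <= 2 by rewrite /s; lra.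
have : 0 <= x * s * (2 * x - s) by rewrite !mulr_ge0 //; lra.
(* The only negative term left is -s^3 / 4 >= -2. It is absorbed by 2/3 r^3 + 4/3 r >= 2 in the
   first inequality and by the summand 2 in the second. *)
have s3 : s ^+ 3 <= 8.
  by apply: le_trans (_ : 2 ^+ 3 <= _); [rewrite lerXn2r ?nnegrE //; lra|lra].
have x3 : x <= x ^+ 3 by apply: ler_eXnr.
by move=> h; split; lra.
Qed.

(** * The grid instance, its integral optimum and its LP value *)

Section GridInstance.
Variables (R : realType) (m : nat).
Local Notation side := (2 * m).+1.
Local Notation V := (option ('I_side * 'I_side)).

Definition center : V := Some (inord m, inord m).

(* [None] is the free vertex; its position here is only used by the LP metric. *)
Definition grid_pos (x : V) : int * int :=
  if x is Some (i, j) then (i%:Z, j%:Z) else (m%:Z, m%:Z).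

Definition grid_terminals : {set V} := [set~ None].

Definition grid_edge : rel V :=
  fun x y => (x == None) && (y == center) || (x == center) && (y == None).

Lemma grid_edge_sym : symmetric grid_edge.
Proof. by move=> x y; rewrite /grid_edge orbC; congr (_ || _); rewrite andbC. Qed.

Lemma grid_edge_irr : irreflexive grid_edge.
Proof. by case=> [x|]; rewrite /grid_edge /= ?andbF. Qed.

Lemma grid_pos_inj : {in grid_terminals &, injective grid_pos}.
Proof.
move=> [[i j]|] [[i' j']|]; rewrite ?inE // => _ _ [ii' jj'].
by congr (Some (_, _)); apply: val_inj.
Qed.

Definition grid_instance : instance R :=
  @Instance R V grid_edge grid_edge_sym grid_edge_irr (fun _ _ => 1)
    (fun _ _ _ => erefl) (fun _ _ _ => ler01) grid_terminals grid_pos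
    grid_pos_inj.

Lemma card_grid_terminals : #|grid_terminals| = (side ^ 2)%N.
Proof. by rewrite cardsC1 card_option card_prod !card_ord. Qed.

Lemma cost_grid (d : V -> V -> R) :
  @cost R grid_instance d = (d None center + d center None) / 2.
Proof.
rewrite /cost /= (bigD1 None) //= [X in _ + X](bigD1 center) //= [X in _ + (_ + X)]big1.
  rewrite addr0 (big_pred1 center) => [|y]; last by rewrite /grid_edge eqxx orbF.
  rewrite (big_pred1 None) => [|y]; last by rewrite /grid_edge eqxx.
  by rewrite !mul1r.
move=> x /andP[/negbTE xN /negbTE xc]; rewrite big1 // => y.
by rewrite /grid_edge xN xc.
Qed.

(** The grid is the full sup ball of radius m around its center, so every lattice point at distance
    at most m is occupied by a terminal. *)
Lemma far_from_center (z : int * int) :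
  (forall x : V, x != None -> z != grid_pos x) ->
  (m.+1 <= supdist z (grid_pos center))%N.
Proof.
move=> zN; rewrite ltnNge; apply/negP; rewrite /supdist /= !inordK; [|lia] => zc.
have /eqP[] := zN (Some (inord `|z.1|%N, inord `|z.2|%N)) isT.
by move: zc; case: z {zN} => [z1 z2] /= zc; rewrite /= !inordK; [congr (_, _)| |]; lia.
Qed.

Lemma opt_value_grid : m.+1%:R <= opt_value grid_instance.
Proof.
apply: lb_le_inf.
(* [lb_le_inf] needs a feasible solution; (-1, 0) is free since grid coordinates are nonnegative. *)
- pose f (x : V) : int * int := if x is Some _ then grid_pos x else (-1, 0).
  exists (@cost R grid_instance (fun u v => dist2 R (f u) (f v))).
  exists f => //; split; last by move=> [?|]; rewrite ?inE.
  move=> [x|] [y|] //.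
  + by apply: grid_pos_inj; rewrite !inE.
  + by case: x => i j [].
  + by case: y => i j [].
- move=> _ [f [f_inj f_pos] <-]; rewrite cost_grid dist2C.
  suff : m.+1%:R <= dist2 R (f center) (f None) by lra.
  rewrite dist2C; apply: le_trans (supdist_le_dist2 _ _ _); rewrite ler_nat.
  rewrite (f_pos center) ?inE //; apply: far_from_center => x xN.
  by apply/eqP; rewrite -[RHS](f_pos x) ?inE // => /f_inj xE; rewrite -xE in xN.
Qed.

(** The second term is twice the cut pseudometric that isolates the free vertex; it separates this
    vertex from the center, with which it shares its position. *)
Definition grid_metric (x y : V) : R :=
  dist2 R (grid_pos x) (grid_pos y) + 2 * ((x == None) (+) (y == None))%:R.

Lemma grid_metric_is_metric : @is_metric R grid_instance grid_metric.
Proof.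
have xor_ge0 (b : bool) : 0 <= 2 * b%:R :> R by case: b; rewrite ?mulr1 ?mulr0.
split.
- by move=> u v; rewrite addr_ge0 ?dist2_ge0.
- move=> u v; split => [/eqP|->]; last by rewrite /grid_metric dist2xx addbb mulr0 addr0.
  rewrite paddr_eq0 ?dist2_ge0 // mulf_eq0 pnatr_eq0 /= => /andP[/eqP/dist2_eq0].
  case: u v => [u|] [v|] //= e; rewrite ?pnatr_eq0 // => _.
  by apply: grid_pos_inj; rewrite ?inE.
- by move=> u v; rewrite /grid_metric dist2C addbC.
- move=> u v x; rewrite /grid_metric.
  have := dist2_triangle R (grid_pos v) (grid_pos u) (grid_pos x).
  by case: (u == None) (v == None) (x == None) => [] [] [] /=; lra.
Qed.

Lemma grid_metric_spreading : @spreading R grid_instance grid_metric.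
Proof.
move=> S u uS.
have cS : (0 < #|S|)%N by apply/card_gt0P; exists u.
have -> : #|S|%:R - 1 = #|S|.-1%:R :> R by rewrite -subn1 natrB.
rewrite powR_3_2.
have [r [le0 le1]] := layer_cake_ge R (Num.sqrt #|S|.-1%:R) (sqrtr_ge0 _).
move: le0 le1; rewrite sqr_sqrtr ?ler0n // => le0 le1.
have inj (A : {set V}) : None \notin A -> {in A &, injective grid_pos}.
  move=> NA x y xA yA; apply: grid_pos_inj; rewrite !inE.
    by apply: contraNneq NA => <-.
  by apply: contraNneq NA => <-.
have xor_ge0 (b : bool) : 0 <= 2 * b%:R :> R by case: b; rewrite ?mulr1 ?mulr0.
(* With q^2 = #|S| - 1, a set without [None] has q^2 + 1 distinct positions, the first case of
   [layer_cake_ge]. Otherwise only q^2 remain after removing [None], and the second case asks for an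
   additional 2. *)
have [NS|NS] := boolP (None \in S); last first.
  apply: le_trans le0 _.
  apply: le_trans (le_trans (sum_dist2_ge R V grid_pos S (grid_pos u) r (inj S NS)) _).
    by rewrite natr1 prednK.
  by apply: ler_sum => v _; rewrite lerDl.
have SD : \sum_(v in S) grid_metric u v
    = grid_metric u None + \sum_(v in S :\ None) grid_metric u v.
  rewrite (bigD1 None) //=; congr (_ + _); apply: eq_bigl => v.
  by rewrite !inE andbC.
have cSN : #|S :\ None| = #|S|.-1 by rewrite (cardsD1 None S) NS.
have NSN : None \notin S :\ None by rewrite !inE.
have := sum_dist2_ge R V grid_pos _ (grid_pos u) r (inj _ NSN).
rewrite SD cSN => sumN.
(* If u is not [None], the additional 2 is the cut term of d(u, [None]); if u is [None], every other
   point of S supplies a 2. *)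
have [uE|uN] := eqVneq u None; last first.
  have : \sum_(v in S :\ None) dist2 R (grid_pos u) (grid_pos v)
      <= \sum_(v in S :\ None) grid_metric u v.
    by apply: ler_sum => v _; rewrite lerDl.
  have : 2 <= grid_metric u None.
    by rewrite /grid_metric (negbTE uN) /= mulr1 lerDr dist2_ge0.
  by move: le1 sumN; lra.
rewrite uE /grid_metric dist2xx addbb mulr0 !add0r.
have -> : \sum_(v in S :\ None)
      (dist2 R (grid_pos None) (grid_pos v) + 2 * ((None == None :> V) (+) (v == None))%:R)
    = \sum_(v in S :\ None) dist2 R (grid_pos None) (grid_pos v) + 2 * #|S|.-1%:R.
  rewrite big_split /=; congr (_ + _); rewrite -cSN -sum1_card natr_sum mulr_sumr.
  by apply: eq_bigr => v; rewrite !inE => /andP[/negbTE-> _].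
(* For S = {[None]} no other point supplies the 2, but the required bound is 0. *)
move: le1 sumN; rewrite uE; case: (#|S|.-1) => [|n] le1 sumN.
  rewrite sqrtr0 expr0n /= mul0r mulr0 addr0.
  by apply: sumr_ge0 => v _; exact: dist2_ge0.
have : 1 <= n.+1%:R :> R by rewrite ler1n.
by move: le1 sumN; lra.
Qed.

Lemma lp_feasible_grid : @lp_feasible R grid_instance grid_metric.
Proof.
split; [exact: grid_metric_is_metric | exact: grid_metric_spreading |].
move=> u v; rewrite !inE => /negbTE uN /negbTE vN.
by rewrite /grid_metric uN vN mulr0 addr0.
Qed.

(** The spreading constraint on {[None], [center]} alone forces this. It makes the LP value positive
    and gives the lower bound that [ge_inf] needs. *)
Lemma lp_cost_ge d : @lp_feasible R grid_instance d ->
  1 / 4 <= @cost R grid_instance d.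
Proof.
move=> [[_ d0 dC _] spread _]; rewrite cost_grid (dC center).
have := spread [set None; center] None; rewrite !inE eqxx => /(_ isT).
rewrite cards2 /= big_setU1 ?inE //= big_set1 (_ : d None None = 0); last exact/d0.
have -> : 2%:R - 1 = 1 :> R by ring.
by rewrite powR1; lra.
Qed.

Lemma lp_value_grid_gt0 : 0 < lp_value grid_instance.
Proof.
apply: (@lt_le_trans _ _ (1 / 4)); first by lra.
apply: lb_le_inf => [|_ [d d_lp <-]]; last exact: lp_cost_ge.
by exists (@cost R grid_instance grid_metric), grid_metric => //; exact: lp_feasible_grid.
Qed.

Lemma lp_value_grid_le2 : lp_value grid_instance <= 2.
Proof.
apply: (@le_trans _ _ (@cost R grid_instance grid_metric)).
  apply: ge_inf; first by exists (1 / 4) => _ [d d_lp <-]; exact: lp_cost_ge.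
  by exists grid_metric => //; exact: lp_feasible_grid.
rewrite cost_grid /grid_metric /= !inordK; [|lia].
by rewrite dist2xx; lra.
Qed.

End GridInstance.

Theorem theorem11 (R : realType) :
  exists c : R, 0 < c /\
    forall k0 : nat, exists k : nat,
      (k0 <= k)%N /\
      ((c * k%:R `^ (1 / 4))%:E <= integrality_gap R k)%E /\
      exists I : instance R,
        #|terminals I| = k /\ 0 < lp_value I /\
        c * k%:R `^ (1 / 4) * lp_value I <= opt_value I.
Proof.
(* The factor 1/2 cancels the bound 2 on the LP value. *)
exists (1 / 2); split; first by lra.
move=> m; exists ((2 * m).+1 ^ 2)%N; split; first by lia.
have lp0 := lp_value_grid_gt0 R m; have lp2 := lp_value_grid_le2 R m.
have gap : 1 / 2 * ((2 * m).+1 ^ 2)%:R `^ (1 / 4) * lp_value (grid_instance R m)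
    <= opt_value (grid_instance R m).
  apply: le_trans (opt_value_grid R m).
  (* Here k^(1/4) = sqrt(2 m + 1), and 2 m + 1 <= (m + 1)^2. *)
  have le_root : ((2 * m).+1 ^ 2)%:R `^ (1 / 4) <= m.+1%:R :> R.
    have -> : ((2 * m).+1 ^ 2)%:R `^ (1 / 4) = Num.sqrt (2 * m).+1%:R :> R.
      rewrite natrX -powR_mulrn ?ler0n // -powRrM.
      by rewrite (_ : 2%:R * (1 / 4) = 2^-1 :> R) ?powR12_sqrt ?ler0n //; lra.
    rewrite -[leRHS]ger0_norm // -sqrtr_sqr ler_wsqrtr // -natrX ler_nat; lia.
  have := powR_ge0 (((2 * m).+1 ^ 2)%:R : R) (1 / 4).
  by move: lp0 lp2 le_root; nra.
split; last by exists (grid_instance R m); rewrite card_grid_terminals.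
apply: le_trans (ereal_sup_ubound _); last first.
  by exists (grid_instance R m); split; [exact: card_grid_terminals|exact: lp0|].
by rewrite lee_fin ler_pdivlMr.
Qed.
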